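(* For every integer $n\ge1$, $m\ge0$ and every $x$, \[ (-1)^n\frac{\mathcal{C}_{n,m}^{(k)}(a,q,L;-x)}{n!}=\sum_{i=1}^{n}\binom{n-1}{i-1}q^{n-i}\frac{\widehat{\mathcal{C}}_{i,m}^{(k)}(a,q,L;x)}{i!},\qquad (-1)^n\frac{\widehat{\mathcal{C}}_{n,m}^{(k)}(a,q,L;-x)}{n!}=\sum_{i=1}^{n}\binom{n-1}{i-1}q^{n-i}\frac{\mathcal{C}_{i,m}^{(k)}(a,q,L;x)}{i!}. \]
   Context: Let $k\ge1$ be an integer, $a,q,l_1,\dots,l_k$ nonzero reals, $l=\prod l_i$, $L=(l_1,\dots,l_k)$; denominators $a+j$ ($j\ge0$ integer) assumed nonzero and $l^{a+i}$ means $l^al^i$. Let $\operatorname{Lif}_k(w;b)=\sum_{n\ge0}\frac{1}{(n+b)^k}\frac{w^n}{n!}$. The generalized $m$-poly-Cauchy polynomials of the first and second kind are defined by the formal power series identities in $z$ \[ \frac{l^a(a+m)^k}{a^k(1+qz)^{x/q}}\operatorname{Lif}_k\!\Big(\frac{l\ln(1+qz)}{q};a+m\Big)=\sum_{n\ge0}\mathcal{C}_{n,m}^{(k)}(a,q,L;x)\frac{z^n}{n!}, \] \[ \frac{l^a(a+m)^k}{a^k(1+qz)^{x/q}}\operatorname{Lif}_k\!\Big(-\frac{l\ln(1+qz)}{q};a+m\Big)=\sum_{n\ge0}\widehat{\mathcal{C}}_{n,m}^{(k)}(a,q,L;x)\frac{z^n}{n!}. \] *)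

(* Defs.v *)
From HB Require Import structures.
From mathcomp Require Import all_boot all_order all_algebra.
From mathcomp Require Import complex.
From mathcomp Require Import reals exp trigo.

Set Implicit Arguments.
Unset Strict Implicit.
Unset Printing Implicit Defensive.

Import Order.TTheory GRing.Theory Num.Theory.
Local Open Scope ring_scope.
Local Open Scope complex_scope.

Section FormalPowerSeries.
Variable K : fieldType.

(* The formal power series sum_n (f n) z^n. *)
Definition fps := nat -> K.

Implicit Types f g : fps.

Definition fps_one : fps := fun n => (n == 0%N)%:R.

Definition fps_X : fps := fun n => (n == 1%N)%:R.

Definition fps_scale (c : K) f : fps := fun n => c * f n.

Definition fps_mul f g : fps := fun n => \sum_(i < n.+1) f i * g (n - i)%N.

Definition fps_pow f (j : nat) : fps := iter j (fps_mul f) fps_one.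

(* The substitution f(g(z)), meaningful when g 0 = 0: then z^j divides g^j,
   and only the terms j <= n contribute to the coefficient of z^n. *)
Definition fps_comp f g : fps := fun n => \sum_(j < n.+1) f j * fps_pow g j n.

(* The first n + 1 coefficients of 1 / f, for f 0 != 0. *)
Fixpoint fps_inv_seq f (n : nat) : seq K :=
  if n is n'.+1 then
    let s := fps_inv_seq f n' in
    rcons s (- (f 0%N)^-1 * \sum_(i < n'.+1) f i.+1 * nth 0 s (n' - i))
  else [:: (f 0%N)^-1].

Definition fps_inv f : fps := fun n => nth 0 (fps_inv_seq f n) n.

Definition fps_exp : fps := fun n => (n`!%:R)^-1.

(* ln (1 + z) *)
Definition fps_ln1p : fps :=
  fun n => if n is n'.+1 then (-1) ^+ n' / n'.+1%:R else 0.

(* ln (1 + q z) *)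
Definition fps_ln1pq (q : K) : fps := fps_comp fps_ln1p (fps_scale q fps_X).

(* (1 + q z) ^ c := exp (c ln (1 + q z)) *)
Definition fps_pow1pq (q c : K) : fps :=
  fps_comp fps_exp (fps_scale c (fps_ln1pq q)).

(* Lif_k (w; b), as a formal power series in w *)
Definition fps_Lif (k : nat) (b : K) : fps :=
  fun n => 1 / (n%:R + b) ^+ k * (1 / n`!%:R).

Lemma size_fps_inv_seq f n : size (fps_inv_seq f n) = n.+1.
Proof. by elim: n => //= n IHn; rewrite size_rcons IHn. Qed.

Lemma nth_fps_inv_seq f n i : (i <= n)%N ->
  nth 0 (fps_inv_seq f n) i = fps_inv f i.
Proof.
elim: n => [|n IHn]; first by rewrite leqn0 => /eqP->.
rewrite leq_eqVlt => /predU1P[-> //|]; rewrite ltnS => lein.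
by rewrite /= nth_rcons size_fps_inv_seq ltnS lein IHn.
Qed.

Lemma fps_mulfV f : f 0%N != 0 -> fps_mul f (fps_inv f) =1 fps_one.
Proof.
move=> f0 [|n]; rewrite /fps_mul /fps_one.
  by rewrite big_ord1 /= /fps_inv /= mulfV.
rewrite big_ord_recl /= subn0 {1}/fps_inv /= nth_rcons size_fps_inv_seq ltnn.
rewrite eqxx mulNr mulrN mulrA mulfV // mul1r addrC; apply/eqP.
rewrite subr_eq0; apply/eqP; apply: eq_bigr => i _.
by rewrite /bump /= add1n subSS nth_fps_inv_seq // leq_subr.
Qed.

End FormalPowerSeries.

Section PolyCauchy.
Variable R : realType.

(* Since l may be negative and a is an arbitrary real, l ^ a is complex in
   general; its values are |l| ^ a * exp (i a theta), where theta runs over the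
   arguments of l. The branch is selected by the integer br, and br = 0 is the
   principal value. *)
Definition cpow (br : int) (l a : R) : R[i] :=
  let theta := (if 0 <= l then 0 else pi) + br%:~R * (2 * pi) in
  (`|l| `^ a)%:C * (cos (a * theta) +i* sin (a * theta)).

Lemma cpow_principal_pos (l a : R) : 0 < l -> cpow 0 l a = (l `^ a)%:C.
Proof.
move=> l0; rewrite /cpow (ltW l0) mul0r addr0 mulr0 cos0 sin0.
by rewrite gtr0_norm // [X in _ * X](_ : _ = 1) ?mulr1.
Qed.

Variables (k : nat) (a q : R) (L : 'I_k -> R) (br : int) (m : nat) (x : R[i]).

Let l : R := \prod_(i < k) L i.

(* l^a (a+m)^k / (a^k (1 + q z)^(x/q)) * Lif_k (c ln (1 + q z); a + m) *)
Definition polyCauchy_gf (c : R[i]) : fps R[i] :=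
  fps_mul
    (fps_scale (cpow br l a * (a%:C + m%:R) ^+ k)
      (fps_inv (fps_scale (a%:C ^+ k) (fps_pow1pq q%:C (x / q%:C)))))
    (fps_comp (fps_Lif k (a%:C + m%:R)) (fps_scale c (fps_ln1pq q%:C))).

Definition polyCauchy1 (n : nat) : R[i] :=
  n`!%:R * polyCauchy_gf (l%:C / q%:C) n.

Definition polyCauchy2 (n : nat) : R[i] :=
  n`!%:R * polyCauchy_gf (- (l%:C / q%:C)) n.

End PolyCauchy.

(* Main.v *)
Require Import Defs.
From HB Require Import structures.
From mathcomp Require Import all_boot all_order all_algebra.
From mathcomp Require Import complex.
From mathcomp Require Import reals exp trigo.
From mathcomp Require Import ring.

Set Implicit Arguments.
Unset Strict Implicit.
Unset Printing Implicit Defensive.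

Import Order.TTheory GRing.Theory Num.Theory.
Local Open Scope ring_scope.
Local Open Scope complex_scope.

(** Put w = z / (1 - q z), so that 1 + q w = 1 / (1 - q z) and hence
    ln (1 + q w) = - ln (1 - q z).  Since x and the argument of Lif_k enter the
    generating function only as multiples of ln (1 + q z), replacing z by w in
    the generating function of one kind at x gives that of the other kind at -x
    with z replaced by -z.  The coefficient of z^n in w^i is
    'C(n-1, i-1) q^(n-i), and comparing coefficients gives both identities. *)

(** * Algebra of substitution in formal power series *)

Section FormalPowerSeriesTheory.
Variable K : fieldType.
Implicit Types (f g h : fps K) (p : {poly K}) (c d : K).

Lemma eq_fps_mul f f' g g' :
  f =1 f' -> g =1 g' -> fps_mul f g =1 fps_mul f' g'.
Proof. by move=> ff gg n; apply: eq_bigr => i _; rewrite ff gg. Qed.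

Lemma fps_powS f j : fps_pow f j.+1 = fps_mul f (fps_pow f j).
Proof. by []. Qed.

Lemma eq_fps_pow f g j : f =1 g -> fps_pow f j =1 fps_pow g j.
Proof. by move=> fg; elim: j => [|j IH] //; apply: eq_fps_mul. Qed.

Lemma eq_fps_comp f g g' : g =1 g' -> fps_comp f g =1 fps_comp f g'.
Proof. by move=> gg n; apply: eq_bigr => i _; rewrite (eq_fps_pow _ gg). Qed.

Lemma eq_fps_scale c f g : f =1 g -> fps_scale c f =1 fps_scale c g.
Proof. by move=> fg n; rewrite /fps_scale fg. Qed.

Lemma eq_fps_inv f g : f =1 g -> fps_inv f =1 fps_inv g.
Proof.
move=> fg n; rewrite /fps_inv; congr (nth 0 _ n).
elim: n => [|n IH] /=; rewrite fg // IH.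
by congr (rcons _ (_ * _)); apply: eq_bigr => i _; rewrite fg.
Qed.

Lemma fps_scaleA c d f : fps_scale c (fps_scale d f) =1 fps_scale (c * d) f.
Proof. by move=> n; rewrite /fps_scale mulrA. Qed.

(** Coefficients up to degree [N] of products and powers depend only on truncations, so identities
    of [{poly K}] carry over to series. *)
Definition fps_trunc (N : nat) f : {poly K} := \poly_(i < N.+1) f i.

Lemma coef_fps_trunc N f n : (n <= N)%N -> (fps_trunc N f)`_n = f n.
Proof. by move=> nN; rewrite coef_poly ltnS nN. Qed.

Lemma fps_mul_trunc N f g n : (n <= N)%N ->
  fps_mul f g n = (fps_trunc N f * fps_trunc N g)`_n.
Proof.
move=> nN; rewrite coefM; apply: eq_bigr => -[i /= lti] _.
by rewrite !coef_fps_trunc // (leq_trans _ nN) // leq_subr.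
Qed.

Lemma fps_pow_trunc N f j n : (n <= N)%N ->
  fps_pow f j n = (fps_trunc N f ^+ j)`_n.
Proof.
elim: j n => [|j IH] n nN; first by rewrite expr0 coef1.
rewrite fps_powS exprS coefM; apply: eq_bigr => -[i /= lti] _.
by rewrite coef_fps_trunc ?(leq_trans _ nN) // IH // (leq_trans _ nN) ?leq_subr.
Qed.

(** Since z divides [f], z^j divides [f]^j. This lets the finite sums that define substitution be
    lengthened at will. *)
Lemma fps_pow_small f j n : f 0%N = 0 -> (n < j)%N -> fps_pow f j n = 0.
Proof.
move=> f0; elim: j n => // j IH n nj; rewrite fps_powS.
rewrite /fps_mul big1 // => -[[|i] /= lti] _; first by rewrite f0 mul0r.
rewrite IH ?mulr0 //; case: n nj lti => // n nj lti.
by rewrite subSS (leq_ltn_trans (leq_subr _ _)).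
Qed.

Lemma coef_comp_fps_trunc N p g n : g 0%N = 0 -> (n <= N)%N ->
  (p \Po fps_trunc N g)`_n = fps_comp (fun i => p`_i) g n.
Proof.
move=> g0 nN; rewrite coef_comp_poly.
under eq_bigr => i _ do rewrite -fps_pow_trunc //.
(* Both sums are extended to a common range; the added terms vanish by the degree of [p] on one side
   and by [fps_pow_small] on the other. *)
pose F i := p`_i * fps_pow g i n.
rewrite (big_ord_widen (maxn (size p) n.+1) F) ?leq_maxl //.
rewrite /fps_comp (big_ord_widen (maxn (size p) n.+1) F) ?leq_maxr //.
rewrite big_mkcond [RHS]big_mkcond; apply: eq_bigr => i _; rewrite /F.
have [_|pi] := ltnP i (size p); last by rewrite nth_default // mul0r if_same.
by have [//|ni] := ltnP i n.+1; rewrite fps_pow_small ?mulr0.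
Qed.

Lemma fps_comp_mul f g h : h 0%N = 0 ->
  fps_comp (fps_mul f g) h =1 fps_mul (fps_comp f h) (fps_comp g h).
Proof.
move=> h0 n.
have compE e i : (i <= n)%N ->
    fps_comp e h i = (fps_trunc n e \Po fps_trunc n h)`_i.
  move=> ni; rewrite coef_comp_fps_trunc //; apply: eq_bigr => -[j /= ji] _.
  by rewrite coef_fps_trunc // (leq_trans _ ni).
(* Multiplicativity is that of polynomial composition, [comp_polyM]. *)
transitivity (((fps_trunc n f * fps_trunc n g) \Po fps_trunc n h)`_n).
  rewrite coef_comp_fps_trunc //; apply: eq_bigr => -[j /= ji] _.
  by rewrite -fps_mul_trunc.
rewrite comp_polyM coefM; apply: eq_bigr => -[i /= ni] _.
by rewrite -!compE ?leq_subr.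
Qed.

Lemma fps_comp_one h : fps_comp (fps_one K) h =1 fps_one K.
Proof.
move=> n; rewrite /fps_comp big_ord_recl big1 => [|i _].
  by rewrite /fps_one /= mul1r addr0.
by rewrite /fps_one /= mul0r.
Qed.

Lemma fps_comp_pow f h j : h 0%N = 0 ->
  fps_comp (fps_pow f j) h =1 fps_pow (fps_comp f h) j.
Proof.
move=> h0; elim: j => [|j IH] n; first exact: fps_comp_one.
by rewrite fps_comp_mul //; apply: eq_fps_mul.
Qed.

Lemma fps_comp_scale c f h :
  fps_comp (fps_scale c f) h =1 fps_scale c (fps_comp f h).
Proof.
by move=> n; rewrite /fps_scale mulr_sumr; apply: eq_bigr => i _; rewrite mulrA.
Qed.

Lemma fps_comp0 f g : fps_comp f g 0%N = f 0%N.
Proof. by rewrite /fps_comp big_ord1 /fps_one /= mulr1. Qed.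

Lemma fps_compA f g h : g 0%N = 0 -> h 0%N = 0 ->
  fps_comp (fps_comp f g) h =1 fps_comp f (fps_comp g h).
Proof.
move=> g0 h0 n.
(* The inner range j <= i is enlarged to a square, so that the two sums can be exchanged. *)
transitivity (\sum_(i < n.+1) \sum_(j < n.+1)
    f j * fps_pow g j i * fps_pow h i n).
  apply: eq_bigr => -[i /= ni] _; rewrite {1}/fps_comp mulr_suml.
  rewrite (big_ord_widen n.+1 (fun j => f j * fps_pow g j i * fps_pow h i n)) //.
  rewrite big_mkcond; apply: eq_bigr => j _.
  by have [//|ij] := ltnP j i.+1; rewrite fps_pow_small // mulr0 mul0r.
rewrite exchange_big; apply: eq_bigr => j _.
rewrite -fps_comp_pow // /fps_comp mulr_sumr.
by apply: eq_bigr => i _; rewrite mulrA.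
Qed.

(** By strong induction: in degree n, all terms but [f 0 * g n] involve only earlier coefficients of
    [g]. *)
Lemma fps_mul_injl f g g' : f 0%N != 0 ->
  fps_mul f g =1 fps_mul f g' -> g =1 g'.
Proof.
move=> f0 gg; elim/ltn_ind => n IH; apply: (mulfI f0).
have := gg n; rewrite /fps_mul !big_ord_recl !subn0.
under eq_bigr => i _.
  rewrite IH; last by rewrite lift0 ltn_subrL (leq_ltn_trans _ (ltn_ord i)).
  over.
by move/addIr.
Qed.

(** Both sides are inverse to [fps_comp f h], whose constant term [f 0] allows cancellation. *)
Lemma fps_comp_inv f h : f 0%N != 0 -> h 0%N = 0 ->
  fps_comp (fps_inv f) h =1 fps_inv (fps_comp f h).
Proof.
move=> f0 h0; apply: (@fps_mul_injl (fps_comp f h)); first by rewrite fps_comp0.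
move=> n; rewrite fps_mulfV ?fps_comp0 // -fps_comp_mul // -(fps_comp_one h).
by apply: eq_bigr => i _; rewrite fps_mulfV.
Qed.

Lemma fps_pow_scaleX c j n :
  fps_pow (fps_scale c (fps_X K)) j n = (n == j)%:R * c ^+ j.
Proof.
elim: j n => [|j IH] n; first by rewrite mulr1.
rewrite fps_powS /fps_mul {1}/fps_scale /fps_X.
case: n => [|n]; first by rewrite big_ord1 /= mulr0 !mul0r.
rewrite 2!big_ord_recl big1 => [|i _]; last by rewrite mulr0 mul0r.
by rewrite /= mulr0 mul0r add0r addr0 mulr1 subSS subn0 IH eqSS mulrCA -exprS.
Qed.

Lemma fps_comp_scaleX c f n : fps_comp f (fps_scale c (fps_X K)) n = c ^+ n * f n.
Proof.
rewrite /fps_comp big_ord_recr big1 => [|i _] /=.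
  by rewrite add0r fps_pow_scaleX eqxx mul1r mulrC.
by rewrite fps_pow_scaleX gtn_eqF ?mul0r ?mulr0.
Qed.

(** * Powers of z / (1 - q z) *)

(* z / (1 - q z) *)
Definition fps_moebius (q : K) : fps K :=
  fun n => if n is n'.+1 then q ^+ n' else 0.

(** This is w f = z f + q z (w f), from w = z + q z w. *)
Lemma fps_mul_moebiusS (q : K) f n :
  fps_mul (fps_moebius q) f n.+1 = f n + q * fps_mul (fps_moebius q) f n.
Proof.
rewrite /fps_mul big_ord_recl /= mul0r add0r big_ord_recl /= mul1r subSS subn0.
congr (_ + _); rewrite mulr_sumr [RHS]big_ord_recl /= mul0r mulr0 add0r.
by apply: eq_bigr => i _; rewrite /bump /= !add1n subSS exprS mulrA.
Qed.

(** The recurrence w^(i+1) = z w^i + q z w^(i+1) turns into Pascal's rule. *)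
Lemma fps_pow_moebius (q : K) i n :
  fps_pow (fps_moebius q) i.+1 n.+1 = 'C(n, i)%:R * q ^+ (n - i).
Proof.
elim: n i => [|n IH] i; rewrite fps_powS fps_mul_moebiusS.
  rewrite -fps_powS (@fps_pow_small _ i.+1) //.
  rewrite mulr0 addr0; case: i => [|i]; first by rewrite mulr1.
  by rewrite fps_pow_small // mul0r.
rewrite -fps_powS IH.
case: i => [|i]; first by rewrite add0r !bin0 !subn0 !mul1r exprS.
rewrite IH binS subSS natrD mulrDl addrC; congr (_ + _).
(* For n <= i the truncated exponents no longer match, but then ['C(n, i.+1)] is 0. *)
have [ni|ni] := ltnP i n; first by rewrite mulrCA -exprS -subSn // subSS.
by rewrite bin_small // !mul0r mulr0.
Qed.

Lemma fps_comp_moebius (q : K) f n : (0 < n)%N ->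
  fps_comp f (fps_moebius q) n =
  \sum_(1 <= i < n.+1) 'C(n.-1, i.-1)%:R * q ^+ (n - i) * f i.
Proof.
case: n => // n _.
(* The term of index 0 drops out: w^0 = 1 has no coefficient in positive degree. *)
rewrite /fps_comp big_ord_recl [fps_pow _ _ _]/(0 : K) mulr0 add0r.
rewrite big_add1 big_mkord; apply: eq_bigr => i _.
by rewrite lift0 fps_pow_moebius subSS mulrC.
Qed.

End FormalPowerSeriesTheory.

(** * The logarithm under the substitution *)

Section Logarithm.
Variable K : numFieldType.
Implicit Types q : K.

Lemma fps_ln1pq0 q : fps_ln1pq q 0%N = 0.
Proof. by rewrite /fps_ln1pq fps_comp0. Qed.

(* ln (1 + q w) = - ln (1 - q z) for w = z / (1 - q z) *)
Lemma fps_ln1pq_moebius q :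
  fps_comp (fps_ln1pq q) (fps_moebius q) =1
  fps_scale (-1) (fps_comp (fps_ln1pq q) (fps_scale (-1) (fps_X K))).
Proof.
case=> [|n]; first by rewrite /fps_scale !fps_comp0 fps_ln1pq0 mulr0.
rewrite fps_comp_moebius // /fps_scale fps_comp_scaleX /fps_ln1pq.
have n0 : n.+1%:R != 0 :> K by rewrite pnatr_eq0.
(* The coefficient of z^(n+1) in - ln (1 - q z) is q^(n+1) / (n+1); its denominator is cleared. *)
apply: (mulfI n0).
have -> : n.+1%:R * (-1 * ((-1) ^+ n.+1 * fps_comp (fps_ln1p K)
    (fps_scale q (fps_X K)) n.+1)) = q ^+ n.+1.
  rewrite fps_comp_scaleX /= -[RHS]mul1r -[X in _ = X * _](sqrr_sign K n).
  by rewrite exprS; field; rewrite nat1r.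
(* Expansion of (1 - 1)^(n+1) = 0 with the term of index 0 moved across. *)
have alt : \sum_(i < n.+1) ('C(n.+1, i.+1)%:R * (-1) ^+ i) = 1 :> K.
  have := exprDn (1 : K) (-1) n.+1; rewrite subrr expr0n /= big_ord_recl /=.
  rewrite expr1n bin0 mulr1 mulr1n => /esym/eqP; rewrite addr_eq0 => /eqP E.
  rewrite [RHS]E -sumrN; apply: eq_bigr => i _.
  by rewrite expr1n mul1r exprS mulN1r mulNrn opprK mulr_natl.
rewrite mulr_sumr big_add1 big_mkord /= -[RHS]mul1r -[X in _ = X * _]alt mulr_suml.
apply: eq_bigr => -[i /= ni] _; rewrite fps_comp_scaleX /= subSS.
have i0 : i.+1%:R != 0 :> K by rewrite pnatr_eq0.
(* Absorption absorbs the factor 1 / (i+1) of the logarithm into the binomial. *)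
have -> : 'C(n.+1, i.+1)%:R = n.+1%:R * 'C(n, i)%:R / i.+1%:R :> K.
  by apply: (canRL (mulfK i0)); rewrite -!natrM mulnC -mul_bin_diag.
have -> : q ^+ n.+1 = q ^+ (n - i) * q ^+ i.+1.
  by rewrite -exprD addnS subnK.
by field; rewrite nat1r.
Qed.

End Logarithm.

(** * Reflection of the generating functions *)

Section PolyCauchyReflection.
Variables (R : realType) (k : nat) (a q : R) (L : 'I_k -> R) (br : int).
Variable m : nat.
Hypothesis a0 : a != 0.
Implicit Types (x c : R[i]) (h : fps R[i]).

(** The variable enters only through ln (1 + q z), so a substitution can be pushed down to the
    logarithm. *)
Lemma fps_comp_polyCauchy_gf x c h : h 0%N = 0 ->
  fps_comp (polyCauchy_gf a q L br m x c) h =1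
  fps_mul
    (fps_scale (cpow br (\prod_(i < k) L i) a * (a%:C + m%:R) ^+ k)
      (fps_inv (fps_scale (a%:C ^+ k) (fps_comp (fps_exp R[i])
        (fps_scale (x / q%:C) (fps_comp (fps_ln1pq q%:C) h))))))
    (fps_comp (fps_Lif k (a%:C + m%:R))
      (fps_scale c (fps_comp (fps_ln1pq q%:C) h))).
Proof.
move=> h0 n; rewrite /polyCauchy_gf fps_comp_mul //.
have ln0 d : fps_scale d (fps_ln1pq (q%:C : R[i])) 0%N = 0.
  by rewrite /fps_scale fps_ln1pq0 mulr0.
apply: eq_fps_mul => {}n; last first.
  by rewrite fps_compA //; apply: eq_fps_comp; apply: fps_comp_scale.
rewrite fps_comp_scale; apply: eq_fps_scale => {}n.
rewrite fps_comp_inv //.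
  apply: eq_fps_inv => {}n; rewrite fps_comp_scale; apply: eq_fps_scale => {}n.
  by rewrite fps_compA //; apply: eq_fps_comp; apply: fps_comp_scale.
(* The series to invert has constant term a^k, as exp starts with 1. *)
rewrite /fps_scale /fps_pow1pq fps_comp0 /fps_exp invr1 mulr1 expf_neq0 //.
by rewrite (inj_eq (@complexI R)).
Qed.

(** Keeping [c] arbitrary serves both kinds at once, as they differ by the sign of [c]. *)
Lemma polyCauchy_gf_reflection x c n : (0 < n)%N ->
  (-1) ^+ n * polyCauchy_gf a q L br m (- x) c n =
  \sum_(1 <= i < n.+1)
    'C(n.-1, i.-1)%:R * q%:C ^+ (n - i) * polyCauchy_gf a q L br m x (- c) i.
Proof.
(* The left side becomes a coefficient after z -> - z, the right side one after z -> z / (1 - q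
   z). *)
move=> n0; rewrite -fps_comp_moebius // -fps_comp_scaleX.
rewrite !fps_comp_polyCauchy_gf //; last by rewrite /fps_scale mulr0.
have lnE d : fps_scale d (fps_comp (fps_ln1pq q%:C) (fps_moebius q%:C)) =1
    fps_scale (- d) (fps_comp (fps_ln1pq q%:C) (fps_scale (-1) (fps_X R[i]))).
  move=> i; rewrite -[- d]mulrN1 -fps_scaleA; apply: eq_fps_scale.
  exact: fps_ln1pq_moebius.
apply/esym/eq_fps_mul => {n n0} n.
  apply: eq_fps_scale => {}n; apply: eq_fps_inv; apply: eq_fps_scale.
  by apply: eq_fps_comp => {}n; rewrite lnE mulNr.
by apply: eq_fps_comp => {}n; rewrite lnE opprK.
Qed.

End PolyCauchyReflection.

Theorem theorem16 (R : realType) (k : nat) (hk : (1 <= k)%N)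
    (a q : R) (L : 'I_k -> R) (br : int)
    (ha0 : a != 0) (hq : q != 0) (hL : forall i, L i != 0)
    (ha : forall j : nat, a + j%:R != 0)
    (n m : nat) (hn : (1 <= n)%N) (x : R[i]) :
  ((-1) ^+ n * (polyCauchy1 a q L br m (- x) n / n`!%:R) =
    \sum_(1 <= i < n.+1)
      'C(n.-1, i.-1)%:R * q%:C ^+ (n - i) * (polyCauchy2 a q L br m x i / i`!%:R))
  /\
  ((-1) ^+ n * (polyCauchy2 a q L br m (- x) n / n`!%:R) =
    \sum_(1 <= i < n.+1)
      'C(n.-1, i.-1)%:R * q%:C ^+ (n - i) * (polyCauchy1 a q L br m x i / i`!%:R)).
Proof.
have factK i (y : R[i]) : i`!%:R * y / i`!%:R = y.
  by rewrite mulrC mulKf // pnatr_eq0 -lt0n fact_gt0.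
(* The reflection is used with c = l / q for the first identity and c = - l / q for the second. *)
split; rewrite /polyCauchy1 /polyCauchy2 factK polyCauchy_gf_reflection //.
  by apply: eq_bigr => i _; rewrite factK.
by apply: eq_bigr => i _; rewrite factK opprK.
Qed.
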